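(* Let $F$ be an arbitrary field, and let $(V,+)$ be a vector space of arbitrary dimension (possibly infinite) over $F$. There is a one-to-one correspondence between (1) abelian regular subgroups $T$ of $\mathrm{Aff}(V)$, and (2) commutative, associative $F$-algebra structures $(V,+,\cdot)$ that one can impose on the vector space structure $(V,+)$, such that the resulting ring is radical. In this correspondence, isomorphism classes of $F$-algebras correspond to conjugacy classes under the action of $\mathrm{GL}(V)$ of abelian regular subgroups of $\mathrm{Aff}(V)$; that is, two algebra structures as in (2) are isomorphic as $F$-algebras if and only if the corresponding subgroups $T_1, T_2$ satisfy $T_2 = \phi^{-1} T_1 \phi$ for some $\phi \in \mathrm{GL}(V)$.
   Context: $\mathrm{GL}(V)$ is the group of invertible $F$-linear maps on $V$. $\mathrm{Aff}(V)$ is the affine group on $V$: the group of permutations of $V$ generated by $\mathrm{GL}(V)$ and the group of translations $N = \{\nu(x) : x \in V\}$, where $\nu(x) : z \mapsto z + x$; one has the semidirect product decomposition $\mathrm{Aff}(V) = \mathrm{GL}(V) N$ with $N$ normal. Maps act on the right. A group $G$ of permutations on a set $\Omega$ is regular if, given any $\alpha \in \Omega$, for each $\beta \in \Omega$ there exists a unique $g \in G$ such that $\alpha g = \beta$. $F$-algebras and rings are not required to have a unit element. An $F$-algebra structure $(V,+,\cdot)$ on $(V,+)$ is an $F$-bilinear product $\cdot$ on the vector space $V$. A (Jacobson) radical ring is an associative ring $(A,+,\cdot)$ in which every element is invertible with respect to the circle operation $x \circ y = x + y + x \cdot y$, so that $(A,\circ)$ is a group (with identity $0$). *)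

(* Defs.v *)
From HB Require Import structures.
From mathcomp Require Import all_boot all_algebra.
From mathcomp Require Import boolp classical_sets functions.

Set Implicit Arguments.
Unset Strict Implicit.
Unset Printing Implicit Defensive.

Import GRing.Theory.
Local Open Scope classical_set_scope.
Local Open Scope ring_scope.

Record permutation (T : Type) := Permutation {
  pmt_fun :> T -> T;
  pmt_inv : T -> T;
  pmt_funK : cancel pmt_fun pmt_inv;
  pmt_invK : cancel pmt_inv pmt_fun }.

Lemma permutationP (T : Type) (s t : permutation T) : s =1 t <-> s = t.
Proof.
split=> [|-> //]; case: s t => [f f' fK f'K] [g g' gK g'K] /= /funext fg.
subst g; have f'g' : f' = g' by apply/funext => x; rewrite -{1}[x]g'K fK.
by subst g'; congr Permutation; apply: Prop_irrelevance.
Qed.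

HB.instance Definition _ (T : Type) := gen_eqMixin (permutation T).
HB.instance Definition _ (T : Type) := gen_choiceMixin (permutation T).

Section PermutationGroup.
Variable T : Type.
Implicit Types s t u : permutation T.

Definition pmt_id : permutation T :=
  @Permutation T idfun idfun (fun=> erefl) (fun=> erefl).

(* Permutations act on the right: the product s * t is s followed by t. *)
Definition pmt_comp s t : permutation T :=
  Permutation (can_comp (pmt_funK t) (pmt_funK s))
              (can_comp (pmt_invK s) (pmt_invK t)).

Definition pmt_symm s : permutation T :=
  Permutation (pmt_invK s) (pmt_funK s).

Fact pmt_compA : associative pmt_comp.
Proof. by move=> s t u; apply/permutationP. Qed.

Fact pmt_comp1s : left_id pmt_id pmt_comp.
Proof. by move=> s; apply/permutationP. Qed.

Fact pmt_comps1 : right_id pmt_id pmt_comp.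
Proof. by move=> s; apply/permutationP. Qed.

Fact pmt_compVs : left_inverse pmt_id pmt_symm pmt_comp.
Proof. by move=> s; apply/permutationP => x /=; rewrite pmt_invK. Qed.

Fact pmt_compsV : right_inverse pmt_id pmt_symm pmt_comp.
Proof. by move=> s; apply/permutationP => x /=; rewrite pmt_funK. Qed.

HB.instance Definition _ := isGroup.Build (permutation T)
  pmt_compA pmt_comp1s pmt_comps1 pmt_compVs pmt_compsV.

(* Since permutations act on the right, the image of a under g is g a. *)
Definition regular (G : set (permutation T)) : Prop :=
  forall a b : T, exists! g, G g /\ g a = b.

End PermutationGroup.

Definition subgroup (gT : groupType) (G : set gT) : Prop := group_closed (mem G).

Definition generated (gT : groupType) (A : set gT) : set gT :=
  smallest (@subgroup gT) A.

Definition abelian_set (gT : groupType) (G : set gT) : Prop :=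
  forall s t, G s -> G t -> commute s t.

Definition conjugate_set (gT : groupType) (G : set gT) (x : gT) : set gT :=
  [set (g ^ x)%g | g in G].

Section Affine.
Variables (F : fieldType) (V : lmodType F).

Definition GL : set (permutation V) :=
  [set g : permutation V | linear g].

Definition translation (x : V) : permutation V :=
  @Permutation V (fun z => z + x) (fun z => z - x) (addrK x) (subrK x).

Definition Aff : set (permutation V) :=
  generated (GL `|` range translation).

Definition abelian_regular_subgroup (T : set (permutation V)) : Prop :=
  [/\ subgroup T, T `<=` Aff, abelian_set T & regular T].

Definition GL_conjugate (T1 T2 : set (permutation V)) : Prop :=
  exists2 phi, GL phi & T2 = conjugate_set T1 phi.

Definition circle (mul : V -> V -> V) (x y : V) : V := x + y + mul x y.

Definition radical (mul : V -> V -> V) : Prop :=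
  forall x, exists y, circle mul x y = 0 /\ circle mul y x = 0.

Definition comm_radical_algebra (mul : V -> V -> V) : Prop :=
  [/\ bilinear_for *:%R *:%R mul, commutative mul, associative mul
    & radical mul].

Definition algebra_isomorphic (mul1 mul2 : V -> V -> V) : Prop :=
  exists2 phi, GL phi & {morph phi : x y / mul1 x y >-> mul2 x y}.

End Affine.

(* Main.v *)
Require Import Defs.
From mathcomp Require Import all_boot all_algebra.
From mathcomp Require Import boolp classical_sets functions.

(** The correspondence sends a radical algebra to the group of its right circle
    translations z |-> z o x.  Such a translation is z |-> (z + z x) + x, an
    affine map, and in a group the right translations form a regular subgroup,
    abelian when the group is ([circle_group_abelian_regular]).

    Conversely, a regular set T of permutations contains for each x exactly one
    element tau_x carrying 0 to x, so T transports its group law to V by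
    x o y := tau_y x.  The product must then be x y := tau_y x - x - y.  It is
    commutative because T is abelian and o is associative because T is closed
    under composition.  As tau_y is affine, x |-> x y is linear, hence by
    commutativity the product is bilinear, and with bilinearity the
    associativity of o becomes that of the product
    ([abelian_regular_circle_group]).

    A regular set of permutations determines the maps tau_x, hence o, hence the
    product, which gives injectivity ([circle_group_inj]).  Finally, conjugation
    by a linear phi turns the right translation by x for one circle operation
    into the right translation by phi x for the transported one.  So the very
    same phi is an algebra isomorphism if and only if it conjugates one group
    to the other ([morph_conjugate_circle_group]). *)

Set Implicit Arguments.
Unset Strict Implicit.
Unset Printing Implicit Defensive.

Import GRing.Theory.
Local Open Scope classical_set_scope.
Local Open Scope ring_scope.

Lemma subgroupP (gT : groupType) (G : set gT) :
  subgroup G <-> G 1%g /\ forall s t, G s -> G t -> G (s * t^-1)%g.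
Proof.
split=> -[G1 GD].
  split=> [|s t Gs Gt]; first exact: set_mem G1.
  by apply/set_mem/GD; apply: mem_set.
by split=> [|s t /set_mem Gs /set_mem Gt]; apply: mem_set => //; apply: GD.
Qed.

Lemma subgroupM (gT : groupType) (G : set gT) s t :
  subgroup G -> G s -> G t -> G (s * t)%g.
Proof.
move=> /subgroupP[G1 GD] Gs Gt.
by rewrite -[t]invgK -[t^-1%g]mul1g; apply: (GD) => //; apply: (GD).
Qed.

Lemma subgroup_generated (gT : groupType) (A : set gT) :
  subgroup (generated A).
Proof.
apply/subgroupP; split=> [M [/subgroupP[] //]|s t As At M MA].
by case: (MA) => /subgroupP[_ MD] _; apply: MD; [apply: As|apply: At].
Qed.

Section Affine.
Variables (F : fieldType) (V : lmodType F).
Implicit Types (g : permutation V) (x y z : V).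

Lemma linear0 (f : V -> V) : linear f -> f 0 = 0.
Proof. by move=> lf; have := lf (-1) 0 0; rewrite scaleN1r addNr scaleN1r addNr. Qed.

Lemma linear_morphD (f : V -> V) : linear f -> forall x y, f (x + y) = f x + f y.
Proof. by move=> lf x y; have := lf 1 x y; rewrite !scale1r. Qed.

(** This form of affinity, free of any base point, is visibly preserved by
    composition and inversion. *)
Definition affine (f : V -> V) :=
  forall a x y z, f (a *: (x - y) + z) = a *: (f x - f y) + f z.

Lemma linear_affine (f : V -> V) : linear f -> affine f.
Proof.
move=> lf a x y z; rewrite lf; congr (_ *: _ + _).
by rewrite -{2}[x](subrK y) (linear_morphD lf (x - y)) addrK.
Qed.

Lemma affine_linear (f : V -> V) : affine f -> linear (fun x => f x - f 0).
Proof. by move=> af a x y; rewrite -{1}[x]subr0 af addrA. Qed.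

Lemma Aff_affine g : Aff g -> affine g.
Proof.
apply: (@smallest_sub _ (@subgroup _) _ [set h : permutation V | affine h]).
  apply/subgroupP; split=> [a x y z //|s t sa ta a x y z /=].
  apply: (can_inj (pmt_funK t)).
  by rewrite ta !(pmt_invK t) -sa.
move=> s [/linear_affine //|[u _ <-]] a x y z /=.
by rewrite opprD [in RHS]addrACA subrr addr0 addrA.
Qed.

(** Membership in Aff only requires the linear part to be linear: it is
    automatically bijective, as the composition of g with a translation. *)
Lemma GL_translation_Aff g x : GL (g * translation (- x))%g -> Aff g.
Proof.
move=> gx.
have -> : g = (g * translation (- x) * translation x)%g.
  by apply/permutationP => z /=; rewrite subrK.
by apply: (subgroupM (@subgroup_generated _ _));
  apply: sub_gen_smallest; [left|right; exists x].
Qed.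

(** The permutations of V that are right translations for the circle operation.
    As z o x is x at z = 0, the translating element x can only be g 0. *)
Definition circle_group (mul : V -> V -> V) : set (permutation V) :=
  [set g | forall z, g z = circle mul z (g 0)].

Section RadicalAlgebra.
Variable mul : V -> V -> V.
Hypothesis mulR : comm_radical_algebra mul.

Local Notation "x * y" := (mul x y) : ring_scope.
Local Notation "x \o y" := (circle mul x y) : ring_scope.

Lemma ralg_mulC : commutative mul. Proof. by case: mulR. Qed.

Lemma ralg_linearl y : linear (mul^~ y).
Proof. by case: mulR => -[lm _] _ _ _; apply: lm. Qed.

Lemma ralg_mulDl x y z : (x + y) * z = x * z + y * z.
Proof. exact: linear_morphD (ralg_linearl z) x y. Qed.

Lemma ralg_mulDr x y z : x * (y + z) = x * y + x * z.
Proof. by rewrite !(ralg_mulC x) ralg_mulDl. Qed.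

Lemma ralg_mul0 z : 0 * z = 0.
Proof. exact: linear0 (ralg_linearl z). Qed.

Lemma circleC : commutative (circle mul).
Proof. by move=> x y; rewrite /circle ralg_mulC (addrC x). Qed.

Lemma circle0 : left_id 0 (circle mul).
Proof. by move=> x; rewrite /circle ralg_mul0 add0r addr0. Qed.

Lemma circleA : associative (circle mul).
Proof.
have mulA : associative mul by case: mulR.
move=> x y z; rewrite /circle !ralg_mulDl !ralg_mulDr mulA !addrA.
by rewrite [LHS](ACl (1*2*5*3*6*4*7)%AC).
Qed.

Lemma circle_permutation x : exists2 g : permutation V,
  circle_group mul g & g 0 = x.
Proof.
have [_ _ _ /(_ x)[y [xy0 yx0]]] := mulR.
have xK : cancel (circle mul ^~ x) (circle mul ^~ y).
  by move=> z; rewrite -circleA xy0 circleC circle0.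
have yK : cancel (circle mul ^~ y) (circle mul ^~ x).
  by move=> z; rewrite -circleA yx0 circleC circle0.
by exists (Permutation xK yK) => [z|]; rewrite /= circle0.
Qed.

Lemma circle_group_ext g h :
  circle_group mul g -> circle_group mul h -> g 0 = h 0 -> g = h.
Proof. by move=> cg ch gh; apply/permutationP => z; rewrite cg gh -ch. Qed.

Lemma subgroup_circle_group : subgroup (circle_group mul).
Proof.
apply/subgroupP; split=> [z /=|s t cs ct z /=].
  by rewrite circleC circle0.
apply: (can_inj (pmt_funK t)).
by rewrite [RHS]ct -circleA -ct !(pmt_invK t).
Qed.

Lemma circle_group_Aff : circle_group mul `<=` @Aff F V.
Proof.
move=> g cg; apply: (@GL_translation_Aff g (g 0)) => a x y /=.
have gE z : g z - g 0 = z + z * g 0 by rewrite cg /circle addrAC addrK.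
by rewrite !gE (ralg_linearl (g 0) a x y) scalerDr addrACA.
Qed.

Lemma circle_group_regular : regular (circle_group mul).
Proof.
move=> a b; have [_ _ _ /(_ a)[a' [aa' a'a]]] := mulR.
have [g cg g0] := circle_permutation (a' \o b).
exists g; split=> [|h [ch hab]].
  by split=> //; rewrite cg g0 circleA aa' circle0.
by apply: circle_group_ext => //; rewrite g0 -hab ch circleA a'a circle0.
Qed.

Lemma circle_group_abelian_regular :
  abelian_regular_subgroup (circle_group mul).
Proof.
split; [exact: subgroup_circle_group|exact: circle_group_Aff| |
        exact: circle_group_regular].
move=> s t cs ct; apply/permutationP => z /=.
by rewrite ct cs [RHS]cs (ct z) -!circleA (circleC (t 0)).
Qed.

End RadicalAlgebra.

Lemma circle_group_inj (mul1 mul2 : V -> V -> V) :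
  comm_radical_algebra mul1 -> comm_radical_algebra mul2 ->
  circle_group mul1 = circle_group mul2 -> mul1 = mul2.
Proof.
move=> R1 R2 E; apply/funext => x; apply/funext => y.
have [g g1 gy] := circle_permutation R1 y.
have g2 : circle_group mul2 g by rewrite -E.
by have := g2 x; rewrite g1 gy => /addrI.
Qed.

Lemma abelian_regular_circle_group (T : set (permutation V)) :
  abelian_regular_subgroup T ->
  exists2 mul, comm_radical_algebra mul & circle_group mul = T.
Proof.
move=> [sT TAff cT rT].
have /choice[tau tauP] x : exists g, T g /\ g 0 = x.
  by have [g [Tg _]] := rT 0 x; exists g.
have Ttau x := (tauP x).1; have tau0 x := (tauP x).2.
have tauE g : T g -> g = tau (g 0).
  move=> Tg; have [h [_ hu]] := rT 0 (g 0).
  by transitivity h; [apply: esym|]; apply: hu.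
have [mul mulE] : exists mul, forall x y, mul x y = tau y x - (x + y).
  by exists (fun x y => tau y x - (x + y)).
have circleE x y : circle mul x y = tau y x by rewrite /circle mulE addrC subrK.
have tauC x y : tau y x = tau x y.
  have /permutationP/(_ 0) := cT _ _ (Ttau x) (Ttau y).
  by rewrite /= !tau0.
have tauM x y : (tau x * tau y)%g = tau (tau y x).
  by rewrite (tauE _ (subgroupM sT (Ttau x) (Ttau y))) /= tau0.
have mulC : commutative mul by move=> x y; rewrite !mulE tauC (addrC x).
have linl y : linear (mul^~ y).
  (* As y = tau y 0, the product by y is the linear part of tau y minus id. *)
  have mulyE x : mul x y = tau y x - tau y 0 - x.
    by rewrite mulE opprD addrA addrAC tau0.
  move=> a u v; rewrite !mulyE.
  rewrite (affine_linear (Aff_affine (TAff _ (Ttau y))) a u v).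
  by rewrite opprD addrACA -!scalerBr.
have linr x : linear (mul x).
  by move=> a u v; rewrite !(mulC x); apply: linl.
have circA : associative (circle mul).
  move=> x y z; rewrite !circleE.
  by have /permutationP/(_ x) := tauM y z.
exists mul.
  split=> //.
  - have mulDl x y z : mul (x + y) z = mul x z + mul y z.
      exact: linear_morphD (linl z) x y.
    have mulDr x y z : mul x (y + z) = mul x y + mul x z.
      exact: linear_morphD (linr x) y z.
    move=> x y z; have := circA x y z.
    (* Both sides expand to the same six terms plus x (y z), resp. (x y) z. *)
    rewrite /circle !mulDl !mulDr !addrA.
    rewrite [X in _ = X -> _](ACl (1*2*4*6*3*5*7)%AC) /=.
    exact: addrI.
  - move=> x; have [g [[Tg gx] _]] := rT x 0.
    have gE : tau (g 0) x = 0 by rewrite -tauE.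
    by exists (g 0); rewrite !circleE gE tauC gE.
apply/seteqP; split=> [g cg|g Tg z]; last by rewrite circleE -tauE.
suff -> : g = tau (g 0) by [].
by apply/permutationP => z; rewrite cg circleE.
Qed.

(** A right translation is known by the image of 0, so phi^-1 tau_x phi lies in
    the second group exactly when it is the translation by phi x, that is, when
    phi (z o x) = phi z o phi x for all z; as phi is additive this is
    multiplicativity of phi. *)
Lemma morph_conjugate_circle_group (mul1 mul2 : V -> V -> V) phi :
  comm_radical_algebra mul1 -> comm_radical_algebra mul2 -> GL phi ->
  {morph phi : x y / mul1 x y >-> mul2 x y} <->
  circle_group mul2 = conjugate_set (circle_group mul1) phi.
Proof.
move=> R1 R2 lphi; have phiD := linear_morphD lphi; have phi0 := linear0 lphi.
have conjE g x : (g ^ phi)%g (phi x) = phi (g x).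
  by rewrite /= [X in phi (g X)](pmt_funK phi).
have phiV z : exists x, z = phi x.
  by exists (pmt_inv phi z); rewrite pmt_invK.
split=> [phiM|E x y].
  have phio x y : phi (circle mul1 x y) = circle mul2 (phi x) (phi y).
    by rewrite /circle !phiD phiM.
  have c1J g : circle_group mul1 g -> circle_group mul2 (g ^ phi)%g.
    by move=> g1 z; have [x ->] := phiV z; rewrite -phi0 !conjE g1 phio.
  apply/seteqP; split=> [g g2|_ [g g1 <-]]; last exact: c1J.
  have [x gx] := phiV (g 0); have [h h1 h0] := circle_permutation R1 x.
  exists h => //; apply: (circle_group_ext (c1J _ h1) g2).
  by rewrite -phi0 conjE h0 phi0.
have [g g1 g0] := circle_permutation R1 y.
have /(_ (phi x)) : circle_group mul2 (g ^ phi)%g by rewrite E; exists g.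
rewrite conjE g1 -{2}phi0 conjE g0 /circle !phiD.
exact: addrI.
Qed.

End Affine.

Theorem theorem1 (F : fieldType) (V : lmodType F) :
  exists Phi : (V -> V -> V) -> set (permutation V),
    set_bij (@comm_radical_algebra F V) (@abelian_regular_subgroup F V) Phi /\
    forall mul1 mul2 : V -> V -> V,
      comm_radical_algebra mul1 -> comm_radical_algebra mul2 ->
      (algebra_isomorphic mul1 mul2 <-> GL_conjugate (Phi mul1) (Phi mul2)).
Proof.
exists (@circle_group F V); split.
  split=> [mul|mul1 mul2 /set_mem R1 /set_mem R2|T /abelian_regular_circle_group].
  - exact: circle_group_abelian_regular.
  - exact: circle_group_inj.
  - by case=> mul R <-; exists mul.
move=> mul1 mul2 R1 R2; split=> -[phi lphi phiP]; exists phi => //.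
  exact/(morph_conjugate_circle_group R1 R2 lphi).
exact/(morph_conjugate_circle_group R1 R2 lphi).
Qed.
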